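(* Let $(X,\mathcal{X})$ be a measurable space, $\Theta$ be a nonempty open interval of $\mathbb{R}$, $\psi:X\times\Theta\to\mathbb{R}$ be a function, and $\xi:\Omega\to X$ be a random variable defined on a probability space $(\Omega,\mathcal{A},\mathbb{P})$. Suppose that (i) $\psi\in\Psi[Z_1](X,\Theta)$, (ii) for each $x,y\in X$ with $\vartheta_1(x)<\vartheta_1(y)$, the function $(\vartheta_1(x),\vartheta_1(y))\ni t\mapsto-\frac{\psi(x,t)}{\psi(y,t)}$ is strictly increasing, (iii) $\psi$ is measurable in its first variable, i.e., for each $t\in\Theta$ the map $X\ni x\mapsto\psi(x,t)$ is measurable with respect to $\mathcal{X}$, (iv) $\mathbb{E}(|\psi(\xi,t)|)<\infty$ for each $t\in\Theta$, (v) there exist $s_0,t_0\in\Theta$ such that $\mathbb{E}(\psi(\xi,s_0))\geq 0$ and $\mathbb{E}(\psi(\xi,t_0))\leq 0$. Then the map $\Theta\ni t\mapsto\mathbb{E}(\psi(\xi,t))$ admits a unique point of sign change in $\Theta$.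
   Context: Point of sign change: for $f:\Theta\to\mathbb{R}$, an element $\vartheta\in\Theta$ is a point of sign change (of decreasing type) for $f$ if $f(t)>0$ for all $t\in\Theta$ with $t<\vartheta$ and $f(t)<0$ for all $t\in\Theta$ with $t>\vartheta$. $\Psi(X,\Theta)$ is the class of functions $\psi:X\times\Theta\to\mathbb{R}$ such that for each $x\in X$ there exist $t_+,t_-\in\Theta$ with $t_+<t_-$ and $\psi(x,t_+)>0>\psi(x,t_-)$. $\psi\in\Psi[Z_1](X,\Theta)$ means that $\psi\in\Psi(X,\Theta)$, that for every $x\in X$ the function $\Theta\ni t\mapsto\psi(x,t)$ has a (necessarily unique) point of sign change $\vartheta_1(x)\in\Theta$, and that $\psi(x,\vartheta_1(x))=0$ for every $x\in X$. *)

(* Defs.v *)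
From HB Require Import structures.
From mathcomp Require Import all_boot all_order all_algebra.
From mathcomp Require Import all_classical all_reals all_analysis.
Import Order.TTheory GRing.Theory Num.Theory.
Import numFieldNormedType.Exports.

Set Implicit Arguments.
Unset Strict Implicit.
Unset Printing Implicit Defensive.

Local Open Scope classical_set_scope.
Local Open Scope ring_scope.

(* A function on Theta is represented by a total function on R, of which every
   definition below only uses the values on Theta. *)

Definition sign_change_point (R : realType) (Theta : set R) (f : R -> R)
    (v : R) : Prop :=
  [/\ Theta v,
      (forall t, Theta t -> t < v -> 0 < f t) &
      (forall t, Theta t -> v < t -> f t < 0)].

Definition Psi (R : realType) (X : Type) (Theta : set R) (psi : X -> R -> R) :
    Prop :=
  forall x : X, exists tp tm : R,
    [/\ Theta tp, Theta tm, tp < tm, 0 < psi x tp & psi x tm < 0].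

(* Meaningful only when a point of sign change exists; see theta1P and, for
   its uniqueness, sign_change_point_unique. *)
Definition theta1 (R : realType) (X : Type) (Theta : set R) (psi : X -> R -> R)
    (x : X) : R :=
  get (sign_change_point Theta (psi x)).

Definition Psi_Z1 (R : realType) (X : Type) (Theta : set R)
    (psi : X -> R -> R) : Prop :=
  [/\ Psi Theta psi,
      (forall x : X, exists v : R, sign_change_point Theta (psi x) v) &
      (forall x : X, psi x (theta1 Theta psi x) = 0)].

Lemma sign_change_point_unique (R : realType) (Theta : set R) (f : R -> R)
    (u v : R) :
  is_interval Theta ->
  sign_change_point Theta f u -> sign_change_point Theta f v -> u = v.
Proof.
move=> itvT.
wlog uv : u v / u <= v => [H|] hu hv.
  by case: (leP u v) => [|/ltW] uv; [exact: H|apply/esym/H].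
apply/eqP; rewrite eq_le uv /= leNgt; apply/negP => ltuv.
have [Tu _ fu] := hu; have [Tv fv _] := hv.
have [um mv] := midf_lt ltuv.
have Tm : Theta ((u + v) / 2).
  by apply: (itvT _ _ Tu Tv); rewrite (ltW um) (ltW mv).
by have := lt_trans (fv _ Tm mv) (fu _ Tm um); rewrite ltxx.
Qed.

Lemma theta1P (R : realType) (X : Type) (Theta : set R) (psi : X -> R -> R)
    (x : X) :
  Psi_Z1 Theta psi -> sign_change_point Theta (psi x) (theta1 Theta psi x).
Proof. by case=> _ /(_ x) [v hv] _; exact: (getI hv). Qed.

(* Main.v *)
Require Import Defs.
From HB Require Import structures.
From mathcomp Require Import all_boot all_order all_algebra.
From mathcomp Require Import all_classical all_reals all_analysis.
From mathcomp Require Import measurable_realfun.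
Import Order.TTheory GRing.Theory Num.Theory.
Import numFieldNormedType.Exports.

Local Open Scope classical_set_scope.
Local Open Scope ring_scope.

(** Write F(t) for the expectation of [psi (xi _) t].  Everything follows from
    one fact: if s < t in Theta and F(s) <= 0, then F(t) < 0.  Read
    contrapositively, it also says that F(t) >= 0 forces F(s) > 0, so F goes
    from positive to negative exactly at the supremum of the set where F >= 0;
    this supremum lies in Theta because F(s0) >= 0 and F(t0) <= 0 enclose it
    between s0 and t0 ([exists_sign_change_point]).

    To prove the fact, look at the points (p, q) = (psi x s, psi x t) of the
    plane, for all x.  Because the sign change of [psi x] is decreasing,
    p <= 0 implies q < 0; and the monotonicity of the ratios says that
    every point with p < 0 has a ratio q / p strictly larger than every point
    with q > 0.  Such a family lies on one side of a line through the origin: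
    there are a, b >= 0 with b q <= a p throughout, and the points lying on the
    line itself are either all in p > 0 or all in q < 0 ([separating_line]).
    Suppose now F(s) <= 0 <= F(t).  Then a psi(xi, s) - b psi(xi, t) is
    nonnegative with nonpositive expectation, so it vanishes almost surely, and
    either psi(xi, s) > 0 almost surely or psi(xi, t) < 0 almost surely.  The
    first contradicts F(s) <= 0, the second F(t) >= 0
    ([integral_sign_propagation]). *)

(** The slope a / b is the supremum c of the ratios q / p over the points with
    q > 0; points with p < 0 have ratios that bound it from above.  A point
    with p < 0 on the line attains c from the other side, and by strictness no
    point with q > 0 can then attain it too.  If one of the two kinds of points
    is missing, an axis separates: b = 0 covers the case where c may be
    infinite. *)
Lemma separating_line (R : realType) (X : Type) (p q : X -> R) :
  (forall x, p x <= 0 -> q x < 0) ->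
  (forall x y, p x < 0 -> 0 < q y -> q x * p y < p x * q y) ->
  exists a b : R, [/\ 0 <= a, 0 <= b, forall x, b * q x <= a * p x &
    (forall x, b * q x = a * p x -> 0 < p x) \/
    (forall x, b * q x = a * p x -> q x < 0)].
Proof.
move=> pq cross.
have qp x : 0 <= q x -> 0 < p x.
  by move=> qx; rewrite ltNge; apply/negP => /pq; rewrite ltNge qx.
have [[y0 qy0]|noq] := pselect (exists y, 0 < q y); last first.
  have q_le0 x : q x <= 0 by rewrite leNgt; apply/negP => ?; apply: noq; exists x.
  exists 0, 1; split => // [x|]; first by rewrite mul1r mul0r.
  by left=> x; rewrite mul1r mul0r => qx; apply: qp; rewrite qx.
have [[x0 px0]|nop] := pselect (exists x, p x < 0); last first.
  have p_ge0 x : 0 <= p x by rewrite leNgt; apply/negP => ?; apply: nop; exists x.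
  exists 1, 0; split => // [x|]; first by rewrite mul1r mul0r.
  by right=> x; rewrite mul1r mul0r => px; apply: pq; rewrite -px.
pose E := [set r | exists2 y, 0 < q y & r = q y / p y].
have ubE x : p x < 0 -> ubound E (q x / p x).
  move=> px _ [y qy ->]; have py := qp _ (ltW qy).
  rewrite ler_pdivrMr// mulrAC ler_ndivlMr// [leRHS]mulrC; exact/ltW/cross.
have supE : has_sup E.
  by split; [exists (q y0 / p y0), y0|exists (q x0 / p x0); exact: ubE].
set c := sup E.
have q_le y : 0 < q y -> q y <= c * p y.
  move=> qy; rewrite -ler_pdivrMr; last exact/qp/ltW.
  by apply: sup_upper_bound => //; exists y.
have c_gt0 : 0 < c.
  by have := lt_le_trans qy0 (q_le _ qy0); rewrite pmulr_lgt0 ?qp ?ltW.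
have above x : q x <= c * p x.
  have [px|px|px0'] := ltgtP (p x) 0.
  - rewrite -ler_ndivlMr//; apply: ge_sup; [by case: supE|exact: ubE].
  - have [qx|/q_le//] := leP (q x) 0.
    by rewrite (le_trans qx)// mulr_ge0 ?ltW.
  - by rewrite px0' mulr0; apply/ltW/pq; rewrite px0'.
exists c, 1; split => // [|x|]; [exact: ltW|by rewrite mul1r|].
(* The side of the origin on which the line is attained decides the
   alternative. *)
have [[x px qx]|nox] := pselect (exists2 x, p x < 0 & q x = c * p x).
  right=> y; rewrite mul1r => qy; have [//|qy_ge0] := ltP (q y) 0.
  have py := qp _ qy_ge0.
  have qy_gt0 : 0 < q y by rewrite qy mulr_gt0.
  by have := cross _ _ px qy_gt0; rewrite qx qy mulrAC mulrA mulrC mulrA ltxx.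
left=> x; rewrite mul1r => qx.
have [px|//|px0'] := ltgtP (p x) 0; first by case: nox; exists x.
by have := pq x; rewrite qx px0' mulr0 lexx ltxx => /(_ isT).
Qed.

Lemma Rintegral_le0_ae_eq0 d (T : measurableType d) (R : realType)
    (mu : {measure set T -> \bar R}) (g : T -> R) :
  mu.-integrable setT (EFin \o g) -> {ae mu, forall x, 0 <= g x} ->
  \int[mu]_x g x <= 0 -> {ae mu, forall x, g x = 0}.
Proof.
move=> ig g0 Ig; have mg := measurable_int _ ig.
have absE : (\int[mu]_x `|(EFin \o g) x| = \int[mu]_x (g x)%:E)%E.
  apply: ae_eq_integral => //; first exact: (measurable_int _ (integrable_abse ig)).
  by apply: filterS g0 => x gx _ /=; rewrite ger0_norm.
have int0 : (\int[mu]_x `|(EFin \o g) x| = 0)%E.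
  apply/eqP; rewrite eq_le integral_ge0// andbT absE.
  by rewrite -[leLHS]fineK ?lee_fin//; exact: integrable_fin_num.
have /(ae_eq_integral_abs mu measurableT mg) := int0.
by apply: filterS => x /(_ I) [].
Qed.

Lemma Rintegral_ae_gt0 d (T : measurableType d) (R : realType)
    (P : probability T R) (g : T -> R) :
  P.-integrable setT (EFin \o g) -> {ae P, forall x, 0 < g x} ->
  0 < \int[P]_x g x.
Proof.
move=> ig g_gt0; rewrite ltNge; apply/negP => Ig.
have g0 : {ae P, forall x, g x = 0}.
  by apply: Rintegral_le0_ae_eq0 => //; apply: filterS g_gt0 => x /ltW.
have : {ae P, forall x : T, False}.
  by apply: filterS2 g_gt0 g0 => x /[swap] ->; rewrite ltxx.
case=> N [mN PN0 TN]; have : P setT = 0%E.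
  apply/eqP; rewrite eq_le measure_ge0 andbT -PN0.
  by rewrite le_measure ?inE// => x _; exact: TN.
by rewrite probability_setT => /eqP; rewrite onee_eq0.
Qed.

(** Integrating the separating line turns the pointwise implication
    [p x <= 0 -> q x < 0] into the same implication between the integrals. *)
Lemma integral_sign_propagation (R : realType) d (T : measurableType d)
    (P : probability T R) (X : Type) (xi : T -> X) (p q : X -> R) :
  P.-integrable setT (EFin \o (p \o xi)) ->
  P.-integrable setT (EFin \o (q \o xi)) ->
  (forall x, p x <= 0 -> q x < 0) ->
  (forall x y, p x < 0 -> 0 < q y -> q x * p y < p x * q y) ->
  \int[P]_w p (xi w) <= 0 -> \int[P]_w q (xi w) < 0.
Proof.
move=> ip iq pq cross Ip; rewrite ltNge; apply/negP => Iq.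
have [a [b [a0 b0 line on_line]]] := separating_line _ _ _ _ pq cross.
have iap : P.-integrable setT (EFin \o (fun w => a * p (xi w))).
  by have := integrableZl measurableT a ip.
have ibq : P.-integrable setT (EFin \o (fun w => b * q (xi w))).
  by have := integrableZl measurableT b iq.
have onE : {ae P, forall w, b * q (xi w) = a * p (xi w)}.
  have : {ae P, forall w, a * p (xi w) - b * q (xi w) = 0}.
    apply: Rintegral_le0_ae_eq0.
    - by have := integrableB measurableT iap ibq.
    - by apply: aeW => w; rewrite subr_ge0.
    - rewrite RintegralB// !RintegralZl// subr_le0.
      by rewrite (@le_trans _ _ 0)// ?mulr_ge0// mulr_ge0_le0.
  by apply: filterS => w /subr0_eq.
case: on_line => on_line.
  suff : 0 < \int[P]_w p (xi w) by rewrite ltNge Ip.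
  by apply: Rintegral_ae_gt0 => //; apply: filterS onE => w /on_line.
suff : 0 < \int[P]_w (- 1 * q (xi w)).
  by rewrite RintegralZl// mulN1r oppr_gt0 ltNge Iq.
apply: Rintegral_ae_gt0; first by have := integrableZl measurableT (-1) iq.
by apply: filterS onE => w /on_line; rewrite mulN1r oppr_gt0.
Qed.

Lemma exists_sign_change_point (R : realType) (Theta : set R) (F : R -> R)
    (s0 t0 : R) :
  is_interval Theta ->
  (forall s t, Theta s -> Theta t -> s < t -> F s <= 0 -> F t < 0) ->
  Theta s0 -> Theta t0 -> 0 <= F s0 -> F t0 <= 0 ->
  exists v, sign_change_point Theta F v.
Proof.
move=> itv Fneg Ts0 Tt0 Fs0 Ft0.
pose E := [set t | Theta t /\ 0 <= F t].
have ubE : ubound E t0.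
  move=> t [Tt Ft]; rewrite leNgt; apply/negP => t0t.
  by have := Fneg _ _ Tt0 Tt t0t Ft0; rewrite ltNge Ft.
have supE : has_sup E by split; [exists s0|exists t0].
exists (sup E); split.
- apply: (itv s0 t0) => //; apply/andP; split.
    by apply: sup_upper_bound.
  by apply: ge_sup => //; case: supE.
- move=> t Tt; rewrite -subr_gt0 => /sup_adherent /(_ supE) [u [Tu Fu]].
  rewrite subKr => tu; rewrite ltNge; apply/negP => Ft.
  by have := Fneg _ _ Tt Tu tu Ft; rewrite ltNge Fu.
- move=> t Tt supt; rewrite ltNge; apply/negP => Ft.
  by have := sup_upper_bound supE (conj Tt Ft); rewrite leNgt supt.
Qed.

Theorem theorem3p1 (R : realType) (dX : measure_display)
    (X : measurableType dX) (Theta : set R)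
    (Theta_neq0 : Theta !=set0) (Theta_open : open Theta)
    (Theta_itv : is_interval Theta)
    (psi : X -> R -> R)
    (dO : measure_display) (Omega : measurableType dO)
    (P : probability Omega R) (xi : {RV P >-> X})
    (h_Z1 : Psi_Z1 Theta psi)
    (h_incr : forall x y : X, theta1 Theta psi x < theta1 Theta psi y ->
      {in `]theta1 Theta psi x, theta1 Theta psi y[ &,
        {homo (fun t : R => - (psi x t / psi y t)) : s t / s < t}})
    (h_meas : forall t : R, Theta t ->
      measurable_fun [set: X] (fun x : X => psi x t))
    (h_int : forall t : R, Theta t ->
      ('E_P[fun w : Omega => (`|psi (xi w) t|)%R] < +oo)%E)
    (h_sign : exists s0 t0 : R, [/\ Theta s0, Theta t0,
      (0 <= 'E_P[fun w : Omega => (psi (xi w) s0)%R])%E &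
      ('E_P[fun w : Omega => (psi (xi w) t0)%R] <= 0)%E]) :
  exists! v : R,
    sign_change_point Theta
      (fun t : R => fine 'E_P[fun w : Omega => (psi (xi w) t)%R]) v.
Proof.
have int_psi t : Theta t -> P.-integrable setT (EFin \o (psi^~ t \o xi)).
  move=> Tt; apply/integrableP; split.
    by apply/measurable_EFinP; apply: measurableT_comp => //; exact: h_meas.
  by have := h_int t Tt; rewrite unlock.
have meanE t : fine 'E_P[fun w => psi (xi w) t] = \int[P]_w psi (xi w) t.
  by rewrite unlock.
have theta x := theta1P x h_Z1.
have psi_theta x : psi x (theta1 Theta psi x) = 0 by case: h_Z1.
have [s0 [t0 [Ts0 Tt0 Fs0 Ft0]]] := h_sign.
have [|v hv] := @exists_sign_change_point R Theta
    (fun t => fine 'E_P[fun w => psi (xi w) t]) s0 t0 Theta_itv _ Ts0 Tt0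
    (fine_ge0 Fs0) (fine_le0 Ft0); last first.
  by exists v; split => // u; exact: sign_change_point_unique.
move=> s t Ts Tt st; rewrite !meanE.
(* The values at s and t locate the zero of [psi x], so that the ratio
   hypothesis applies to the pairs it is needed for. *)
have before x : psi x s < 0 -> theta1 Theta psi x < s.
  have [_ pos _] := theta x.
  by case: (ltgtP s) => // [/(pos _ Ts)/lt_gtF ->|->]; rewrite ?psi_theta ?ltxx.
have after y : 0 < psi y t -> t < theta1 Theta psi y.
  have [_ _ neg] := theta y.
  by case: (ltgtP t) => // [/(neg _ Tt)/lt_gtF ->|->]; rewrite ?psi_theta ?ltxx.
apply: (@integral_sign_propagation R _ Omega P X xi (psi^~ s) (psi^~ t)).
- exact: int_psi.
- exact: int_psi.
- move=> x px; have [_ pos neg] := theta x; apply: neg => //.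
  rewrite (le_lt_trans _ st)// leNgt; apply/negP => /(pos _ Ts).
  by rewrite ltNge px.
- move=> x y /[dup] px /before xs /[dup] qy /after ty.
  have xy := lt_trans (lt_trans xs st) ty.
  have [_ pos _] := theta y.
  have py : 0 < psi y s by apply: pos => //; exact: lt_trans ty.
  have := h_incr x y xy s t.
  rewrite !in_itv/= xs ty (lt_trans xs st) (lt_trans st ty) => /(_ isT isT st).
  by rewrite ltrN2 ltr_pdivrMr// mulrAC ltr_pdivlMr.
Qed.
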